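(* Let $G$ be a connected graph of order $n$ with minimum degree $\delta$. Then \[ \frac{(\delta+n-1)\sqrt{\delta(n-1)}}{2\left(\delta^2+(n-1)^2\right)}\,SDD(G)\le AG(G)\le \frac12\,SDD(G). \] Moreover, equality holds in the left-hand inequality if and only if $G$ is isomorphic to $K_{1,n-1}$ or to $K_n$, and equality holds in the right-hand inequality if and only if $G$ is a $\delta$-regular graph.
   Context: All graphs are finite, simple and undirected. $d_i$ is the degree of vertex $v_i$; $i\sim j$ denotes an edge $v_iv_j$ and sums over $i\sim j$ run over edges, each once. $AG(G)=\sum_{i\sim j}\frac12\left(\sqrt{d_i/d_j}+\sqrt{d_j/d_i}\right)$ and the symmetric division deg index is $SDD(G)=\sum_{i\sim j}\left(\frac{d_i}{d_j}+\frac{d_j}{d_i}\right)$. *)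

(* Defs.v *)
From mathcomp Require Import all_boot all_order all_algebra.
Set Implicit Arguments.
Unset Strict Implicit.
Unset Printing Implicit Defensive.
Import Order.TTheory GRing.Theory Num.Theory.

(* Real quantities live in an arbitrary real closed field, which covers every *)
(* realType.                                                                  *)

Record sgraph := SGraph {
  svertex :> finType;
  sedge : rel svertex;
  sedge_sym : symmetric sedge;
  sedge_irrefl : irreflexive sedge }.

Definition deg (G : sgraph) (x : G) : nat := #|[set y | sedge x y]|.

(* The null graph is not connected.                                           *)
Definition connected (G : sgraph) : Prop :=
  0 < #|G| /\ forall x y : G, connect (@sedge G) x y.

Definition is_min_degree (G : sgraph) (delta : nat) : Prop :=
  (forall x : G, delta <= deg x) /\ (exists x : G, deg x = delta).

Definition regular (G : sgraph) (k : nat) : Prop := forall x : G, deg x = k.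

Definition isomorphic (G H : sgraph) : Prop :=
  exists2 f : G -> H, bijective f & {mono f : x y / sedge x y}.

Definition complete_rel (n : nat) : rel 'I_n := fun x y => x != y.

Lemma complete_sym n : symmetric (@complete_rel n).
Proof. by move=> x y; rewrite /complete_rel eq_sym. Qed.

Lemma complete_irrefl n : irreflexive (@complete_rel n).
Proof. by move=> x; rewrite /complete_rel eqxx. Qed.

Definition complete_graph (n : nat) : sgraph :=
  SGraph (@complete_sym n) (@complete_irrefl n).

Definition complete_bipartite_rel (m n : nat) : rel ('I_m + 'I_n) :=
  fun x y => match x, y with
             | inl _, inr _ | inr _, inl _ => true
             | _, _ => false
             end.

Lemma complete_bipartite_sym m n : symmetric (@complete_bipartite_rel m n).
Proof. by case=> x [] y. Qed.

Lemma complete_bipartite_irrefl m n :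
  irreflexive (@complete_bipartite_rel m n).
Proof. by case. Qed.

Definition complete_bipartite (m n : nat) : sgraph :=
  SGraph (@complete_bipartite_sym m n) (@complete_bipartite_irrefl m n).

(* Each edge is represented once, by its endpoints listed in the order of the *)
(* canonical enumeration of the vertices.                                     *)
Definition edges (G : sgraph) : {set G * G} :=
  [set p | sedge p.1 p.2 && (enum_rank p.1 < enum_rank p.2)].

Local Open Scope ring_scope.

Definition AG (R : rcfType) (G : sgraph) : R :=
  \sum_(p in edges G)
    2^-1 * (Num.sqrt ((deg p.1)%:R / (deg p.2)%:R)
            + Num.sqrt ((deg p.2)%:R / (deg p.1)%:R)).

Definition SDD (R : rcfType) (G : sgraph) : R :=
  \sum_(p in edges G)
    ((deg p.1)%:R / (deg p.2)%:R + (deg p.2)%:R / (deg p.1)%:R).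

Arguments AG : clear implicits.
Arguments SDD : clear implicits.

(* For the one-vertex graph (delta = 0, n = 1) this is 0 / 0, i.e. 0 here;    *)
(* both indices are then empty sums.                                          *)
Definition lower_coef (R : rcfType) (n delta : nat) : R :=
  ((delta%:R + n%:R - 1) * Num.sqrt (delta%:R * (n%:R - 1)))
  / (2 * (delta%:R ^+ 2 + (n%:R - 1) ^+ 2)).

Arguments lower_coef : clear implicits.

(* Main.v *)
Require Import Defs.
From mathcomp Require Import all_boot all_order all_algebra.
From mathcomp Require Import perm ring.
Set Implicit Arguments.
Unset Strict Implicit.
Unset Printing Implicit Defensive.
Import Order.TTheory GRing.Theory Num.Theory.
Local Open Scope ring_scope.

(** Put [s = sqrt (a / b) + sqrt (b / a)] for an edge with end degrees [a], [b]
    and let [S] be the value of [s] at [(delta, n - 1)].  The edge contributes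
    [s / 2] to AG and [s ^ 2 - 2] to SDD, and the coefficient on the left is
    [S / (2 (S ^ 2 - 2))].  Both bounds hold edge by edge: [s >= 2] on the
    right, and on the left
    [s (S ^ 2 - 2) - S (s ^ 2 - 2) = (S - s) (s S + 2) >= 0].
    Hence equality holds on the right iff adjacent vertices have equal degrees,
    and on the left iff every edge joins degree [delta] to degree [n - 1]; in
    the latter case a vertex of degree [n - 1] is adjacent to all others. *)

(** Generic in [T] so that it serves both for degrees in [nat] and for their images in [R]. *)
Definition end_values (T : eqType) (d e a b : T) : bool :=
  ((a == d) && (b == e)) || ((a == e) && (b == d)).

Lemma end_valuesC (T : eqType) (d e a b : T) :
  end_values d e a b = end_values d e b a.
Proof. by rewrite /end_values orbC andbC [(a == d) && _]andbC. Qed.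

(** * Bounds for a single edge, with their equality cases *)

Section EdgeInequalities.

Variable R : rcfType.
Implicit Types a b d e u v p q : R.

Lemma sqrtr_div a b :
  0 <= a -> 0 <= b -> Num.sqrt (a / b) = Num.sqrt a / Num.sqrt b.
Proof. by move=> a_ge0 b_ge0; rewrite sqrtrM // sqrtrV. Qed.

(** Writing each degree as a square removes the roots and leaves rational identities for [field]. *)
Lemma gt0_sqr a : 0 < a -> exists2 u, 0 < u & a = u ^+ 2.
Proof. by move=> a_gt0; exists (Num.sqrt a); rewrite ?sqrtr_gt0 ?sqr_sqrtr ?ltW. Qed.

Lemma leif_mul_cross u v p q : 0 < p -> p <= v -> 0 < u -> u <= q ->
  u * p <= q * v ?= iff ((u == q) && (v == p)).
Proof.
move=> p_gt0 le_pv u_gt0 le_uq; apply/leifP.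
have q_gt0 := lt_le_trans u_gt0 le_uq.
have [-> | ne_uq] /= := eqVneq u q.
  have [-> //| ne_vp] := eqVneq v p.
  by rewrite ltr_pM2l // lt_def ne_vp.
apply: (@lt_le_trans _ _ (q * p)); last by rewrite ler_pM2l.
by rewrite ltr_pM2r // lt_def eq_sym ne_uq.
Qed.

Lemma edge_lower a b d e :
    0 < d -> d <= a -> a <= e -> d <= b -> b <= e ->
  ((d + e) * Num.sqrt (d * e)) / (2 * (d ^+ 2 + e ^+ 2)) * (a / b + b / a)
    <= 2^-1 * (Num.sqrt (a / b) + Num.sqrt (b / a))
    ?= iff end_values d e a b.
Proof.
move=> d_gt0 le_da le_ae le_db le_be.
have a_gt0 := lt_le_trans d_gt0 le_da; have b_gt0 := lt_le_trans d_gt0 le_db.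
have e_gt0 := lt_le_trans a_gt0 le_ae.
rewrite !sqrtr_div ?ltW // sqrtrM ?ltW //.
case: (gt0_sqr d_gt0) (gt0_sqr e_gt0) (gt0_sqr a_gt0) (gt0_sqr b_gt0).
move=> p p_gt0 dE [q q_gt0 eE] [u u_gt0 aE] [v v_gt0 bE]; subst.
rewrite /end_values !eqrXn2 ?ltW // !sqrtr_sqr !gtr0_norm //.
have [p_ge0 q_ge0 u_ge0 v_ge0] := And4 (ltW p_gt0) (ltW q_gt0) (ltW u_gt0) (ltW v_gt0).
move: le_da le_ae le_db le_be; rewrite !ler_pXn2r ?nnegrE // => le_pu le_uq le_pv le_vq.
(* [q * v - u * p] and [q * u - v * p] are the two factors of [S - s] with denominators cleared;
   each vanishes at exactly one orientation of the extremal pair. *)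
have [le1 eq1] := leif_mul_cross p_gt0 le_pv u_gt0 le_uq.
have [le2 eq2] := leif_mul_cross p_gt0 le_pu v_gt0 le_vq.
have D_gt0 : 0 < 2 * (p ^+ 4 + q ^+ 4) * (u ^+ 2 * v ^+ 2).
  by rewrite !mulr_gt0 ?addr_gt0 ?exprn_gt0.
have F_gt0 : 0 < (p ^+ 2 + q ^+ 2) * (u ^+ 2 + v ^+ 2) + 2 * (p * q * u * v).
  by rewrite addr_gt0 // !mulr_gt0 ?addr_gt0 ?exprn_gt0.
set L := (X in X <= _ ?= iff _); set M := (X in _ <= X ?= iff _).
(* This is [(S - s) (s S + 2) / (2 (S ^ 2 - 2))], where [S = q / p + p / q] and
   [s = u / v + v / u]. *)
have diffE : M - L = (q * v - u * p) * (q * u - v * p)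
    * ((p ^+ 2 + q ^+ 2) * (u ^+ 2 + v ^+ 2) + 2 * (p * q * u * v))
    / (2 * (p ^+ 4 + q ^+ 4) * (u ^+ 2 * v ^+ 2)).
  rewrite /L /M; field.
  rewrite !gt_eqF //=.
  by rewrite addr_gt0 ?exprn_gt0.
split.
  rewrite -subr_ge0 diffE divr_ge0 ?(ltW D_gt0) //.
  by rewrite !mulr_ge0 ?subr_ge0 // ltW.
rewrite eq_sym -subr_eq0 diffE !mulf_eq0 invr_eq0 (gt_eqF D_gt0) (gt_eqF F_gt0).
rewrite !orbF !subr_eq0 ![q * _ == _]eq_sym eq1 eq2 orbC.
by rewrite [(v == q) && _]andbC.
Qed.

Lemma edge_upper a b : 0 < a -> 0 < b ->
  2^-1 * (Num.sqrt (a / b) + Num.sqrt (b / a)) <= 2^-1 * (a / b + b / a)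
    ?= iff (a == b).
Proof.
move=> a_gt0 b_gt0; rewrite !sqrtr_div ?ltW //.
case: (gt0_sqr a_gt0) (gt0_sqr b_gt0) => u u_gt0 aE [v v_gt0 bE]; subst.
rewrite eqrXn2 ?ltW // !sqrtr_sqr !gtr0_norm //.
set L := (X in X <= _ ?= iff _); set M := (X in _ <= X ?= iff _).
(* With [s = u / v + v / u] this is [(s - 2) (s + 1) / 2]. *)
have diffE : M - L = (u - v) ^+ 2 * (u ^+ 2 + u * v + v ^+ 2)
    / (2 * (u ^+ 2 * v ^+ 2)).
  by rewrite /L /M; field; rewrite !gt_eqF.
have D_gt0 : 0 < 2 * (u ^+ 2 * v ^+ 2) by rewrite !mulr_gt0 ?exprn_gt0.
have F_gt0 : 0 < u ^+ 2 + u * v + v ^+ 2.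
  by rewrite !addr_gt0 ?exprn_gt0 ?mulr_gt0.
split.
  by rewrite -subr_ge0 diffE divr_ge0 ?(ltW D_gt0) // mulr_ge0 ?sqr_ge0 ?ltW.
rewrite eq_sym -subr_eq0 diffE !mulf_eq0 invr_eq0 (gt_eqF D_gt0) (gt_eqF F_gt0).
by rewrite !orbF orbb subr_eq0.
Qed.

End EdgeInequalities.

(** Any bijection will do after composing it with a transposition; this later sends the centre of a
    star to the centre. *)
Lemma eq_card_pointed_bij (S T : finType) (c : S) (c' : T) :
  #|S| = #|T| -> exists2 f : S -> T, bijective f & f c = c'.
Proof.
move=> eqST; pose g x := enum_val (cast_ord eqST (enum_rank x)).
have g_inj : injective g.
  by move=> x y /enum_val_inj /cast_ord_inj /enum_rank_inj.
exists (tperm (g c) c' \o g); last by rewrite /= tpermL.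
by apply: inj_card_bij; [exact: inj_comp perm_inj g_inj | rewrite eqST].
Qed.

(** * Degrees, stars and complete graphs *)

Section Graphs.

Variable G : sgraph.
Implicit Types (x y z c : G) (n k delta : nat).

(** By irreflexivity the neighbourhood lies in the complement of [x]; equal cardinality makes it the
    whole complement. *)
Lemma deg_leqif x : (deg x <= #|G|.-1 ?= iff [forall y, sedge x y == (y != x)])%N.
Proof.
have sub : [set y | sedge x y] \subset [set~ x].
  by apply/subsetP=> y; rewrite !inE; apply: contraTneq => ->; rewrite sedge_irrefl.
have := subset_leqif_cards sub; rewrite cardsC1 /deg => le_eq.
split; first by case: le_eq.
rewrite (eq_leqif le_eq); apply/eqP/forallP=> [/setP E y | E].
  by have := E y; rewrite !inE => ->.
by apply/setP=> y; rewrite !inE (eqP (E y)).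
Qed.

Lemma deg_gt0 x y : sedge x y -> (0 < deg x)%N.
Proof. by move=> xy; apply/card_gt0P; exists y; rewrite inE. Qed.

Lemma connected_neighbour x y : connected G -> x != y -> exists z, sedge x z.
Proof.
case=> _ /(_ x y) /connectP[[|z p] /= path_p ->]; first by rewrite eqxx.
by case/andP: path_p => xz _ _; exists z.
Qed.

Lemma connected_deg_gt0 x y z : connected G -> sedge x y -> (0 < deg z)%N.
Proof.
move=> conn xy; have [->|ne_zx] := eqVneq z x; first exact: deg_gt0 xy.
by have [w /deg_gt0] := connected_neighbour conn ne_zx.
Qed.

(** [edges] keeps one orientation of each edge; symmetry of [C] supplies the other. *)
Lemma edges_forallP (C : rel nat) : symmetric C ->
  reflect (forall x y, sedge x y -> C (deg x) (deg y))
          [forall (p | p \in edges G), C (deg p.1) (deg p.2)].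
Proof.
move=> C_sym; apply: (iffP forall_inP) => [Cedges x y xy | Call [x y]]; last first.
  by rewrite inE => /andP[/= /Call].
have [lt_xy | lt_yx | /ord_inj/enum_rank_inj eq_xy] :=
    ltngtP (enum_rank x) (enum_rank y).
- by apply: (Cedges (x, y)); rewrite inE /= xy.
- by rewrite C_sym; apply: (Cedges (y, x)); rewrite inE /= sedge_sym xy.
- by rewrite eq_xy sedge_irrefl in xy.
Qed.

(** The degree is constant along a path starting at a vertex of degree [delta]. *)
Lemma connected_regular delta : connected G -> is_min_degree G delta ->
  (forall x y, sedge x y -> deg x == deg y) <-> regular G delta.
Proof.
move=> [_ conn] [_ [x0 deg_x0]]; split=> [eq_deg x | reg x y _]; last first.
  by rewrite !reg.
have /connectP[p path_p ->] := conn x0 x.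
elim: p x0 deg_x0 path_p => //= y p IHp x0 deg_x0 /andP[/eq_deg/eqP eq_xy].
by apply: IHp; rewrite -eq_xy.
Qed.

Lemma isomorphic_complete n : #|G| = n ->
  isomorphic G (complete_graph n) <-> forall x y, sedge x y = (x != y).
Proof.
move=> cardG; split=> [[f f_bij f_mono] x y | sedgeE].
  by rewrite -f_mono /= /complete_rel (bij_eq f_bij).
pose f x : complete_graph n := cast_ord cardG (enum_rank x).
have f_inj : injective f by move=> x y /cast_ord_inj /enum_rank_inj.
exists f; first by apply: inj_card_bij; rewrite // card_ord cardG.
by move=> x y; rewrite /= /complete_rel (inj_eq f_inj) sedgeE.
Qed.

(** Adjacency as an exclusive or depends only on the centre, so a bijection matching centres is an
    isomorphism. *)
Lemma star_edgeE m (u v : complete_bipartite 1 m) :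
  sedge u v = (u == inl ord0) (+) (v == inl ord0).
Proof.
by case: u v => [i|i] [j|j]; rewrite ?(ord1 i) ?(ord1 j) ?eqxx.
Qed.

Lemma isomorphic_star n : #|G| = n -> (0 < n)%N ->
  isomorphic G (complete_bipartite 1 n.-1) <->
  exists c, forall x y, sedge x y = (x == c) (+) (y == c).
Proof.
move=> cardG n_gt0; split=> [[f [g fK gK] f_mono] | [c sedgeE]].
  exists (g (inl ord0)) => x y.
  by rewrite -f_mono star_edgeE -!(can_eq gK) !fK.
have [|f f_bij fc] := @eq_card_pointed_bij G (complete_bipartite 1 n.-1) c (inl ord0).
  by rewrite card_sum !card_ord cardG add1n prednK.
by exists f => // x y; rewrite star_edgeE -fc !(bij_eq f_bij) sedgeE.
Qed.

Lemma deg_complete x :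
  (forall x y, sedge x y = (x != y)) -> deg x = #|G|.-1.
Proof.
move=> sedgeE; apply/eqP; rewrite (eq_leqif (deg_leqif x)).
by apply/forallP=> y; rewrite sedgeE [y == x]eq_sym.
Qed.

Lemma deg_star c x : (forall x y, sedge x y = (x == c) (+) (y == c)) ->
  deg x = if x == c then #|G|.-1 else 1%N.
Proof.
move=> sedgeE; have [->|/negbTE x_neq_c] := eqVneq x c.
  apply/eqP; rewrite (eq_leqif (deg_leqif c)).
  by apply/forallP=> y; rewrite sedgeE eqxx addTb.
rewrite /deg -(cards1 c); congr #|pred_of_set _|.
by apply/setP=> y; rewrite !inE sedgeE x_neq_c.
Qed.

(** If [delta] is maximal, every vertex dominates and the graph is complete. Otherwise a neighbour
    [c] of a vertex of degree [delta] dominates, and all other vertices, being adjacent to [c], have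
    degree [delta]. *)
Lemma extremal_edges delta : connected G -> is_min_degree G delta ->
  (forall x y, sedge x y -> end_values delta #|G|.-1 (deg x) (deg y)) <->
  (exists c, forall x y, sedge x y = (x == c) (+) (y == c)) \/
  (forall x y, sedge x y = (x != y)).
Proof.
move=> conn [min_delta [x0 deg_x0]]; split=> [ends | [[c sedgeE] | sedgeE] x y xy].
- have dominating x y : deg x = #|G|.-1 -> sedge x y = (y != x).
    by move/eqP; rewrite (eq_leqif (deg_leqif x)) => /forallP/(_ y)/eqP.
  have [delta_max | delta_nmax] := eqVneq delta #|G|.-1.
    right=> x y; rewrite eq_sym; apply: dominating.
    by apply/eqP; rewrite eqn_leq (deg_leqif x).1 -delta_max min_delta.
  (* If [x0] were the only vertex it would dominate vacuously, making [delta] maximal. *)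
  left; have [y ne_x0y] : exists y, x0 != y.
    apply/existsP; apply: contraR delta_nmax; rewrite negb_exists => /forallP all_x0.
    rewrite -deg_x0 (eq_leqif (deg_leqif x0)); apply/forallP=> y.
    by have /negPn/eqP <- := all_x0 y; rewrite sedge_irrefl eqxx.
  have [c x0c] := connected_neighbour conn ne_x0y; exists c.
  have deg_c : deg c = #|G|.-1.
    have := ends _ _ x0c; rewrite /end_values deg_x0 eqxx (negbTE delta_nmax) orbF.
    by move/eqP.
  have deg_nc x : x != c -> deg x = delta.
    rewrite -(dominating c x deg_c) => /ends.
    by rewrite /end_values deg_c eqxx eq_sym (negbTE delta_nmax) => /eqP.
  move=> x y'; have [->|x_neq_c] := eqVneq x c; first by rewrite dominating.
  have [->|y_neq_c] := eqVneq y' c; first by rewrite sedge_sym dominating.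
  (* An edge avoiding [c] has both ends of degree [delta], yet one end must have the maximal
     degree. *)
  apply: contraNF delta_nmax => /ends.
  by rewrite /end_values !deg_nc // => /orP[] /andP[].
- have delta_gt0 : (0 < delta)%N by rewrite -deg_x0 (connected_deg_gt0 _ conn xy).
  (* A leaf has degree 1, and the edge at hand makes [delta] positive. *)
  have delta1 z : z != c -> delta = 1%N.
    move=> z_neq_c; apply/eqP; rewrite eqn_leq delta_gt0 andbT.
    by have := min_delta z; rewrite (deg_star z sedgeE) (negbTE z_neq_c).
  have := xy; rewrite sedgeE /end_values !(deg_star _ sedgeE).
  have [xc|x_neq_c] := eqVneq x c; have [yc|y_neq_c] := eqVneq y c => // _.
    by rewrite (delta1 y) // !eqxx orbT.
  by rewrite (delta1 x) // !eqxx.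
- by rewrite /end_values -deg_x0 !deg_complete ?eqxx.
Qed.

End Graphs.

Theorem theorem10 (R : rcfType) (G : sgraph) (n delta : nat)
    (hn : #|G| = n) (hconn : connected G) (hdelta : is_min_degree G delta) :
  [/\ lower_coef R n delta * SDD R G <= AG R G,
      AG R G <= 2^-1 * SDD R G,
      lower_coef R n delta * SDD R G = AG R G <->
        isomorphic G (complete_bipartite 1 n.-1) \/
        isomorphic G (complete_graph n)
    & AG R G = 2^-1 * SDD R G <-> regular G delta].
Proof.
have n_gt0 : (0 < n)%N by rewrite -hn; case: hconn.
have pred_nR : n%:R - 1 = n.-1%:R :> R by rewrite -{1}(prednK n_gt0) -natr1 addrK.
(* Positivity is claimed only in the presence of an edge, so the one-vertex graph needs no separate
   case. *)
have edge_deg (p : G * G) : p \in edges G -> [/\ (0 < deg p.1)%N, (0 < deg p.2)%N & (0 < delta)%N].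
  rewrite inE => /andP[p_edge _]; case: hdelta => _ [x0 <-].
  by split; apply: connected_deg_gt0 hconn p_edge.
have lower : lower_coef R n delta * SDD R G <= AG R G
    ?= iff [forall (p | p \in edges G), end_values delta n.-1 (deg p.1) (deg p.2)].
  (* [leif_sum] adds the edge bounds: the sums agree exactly when all the terms do. *)
  rewrite /SDD /AG mulr_sumr; apply: leif_sum => p p_edge.
  have [_ _ delta_gt0] := edge_deg p p_edge.
  have [[min_delta _] deg_max] := (hdelta, fun x : G => (deg_leqif x).1).
  rewrite hn in deg_max.
  rewrite /lower_coef -addrA pred_nR.
  have -> : end_values delta n.-1 (deg p.1) (deg p.2) =
      end_values (delta%:R : R) n.-1%:R (deg p.1)%:R (deg p.2)%:R.
    by rewrite /end_values !eqr_nat.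
  by apply: edge_lower; rewrite ?ltr0n ?ler_nat.
have upper : AG R G <= 2^-1 * SDD R G
    ?= iff [forall (p | p \in edges G), deg p.1 == deg p.2].
  rewrite /SDD /AG mulr_sumr; apply: leif_sum => p p_edge.
  have [deg1_gt0 deg2_gt0 _] := edge_deg p p_edge.
  by rewrite -(eqr_nat R); apply: edge_upper; rewrite ltr0n.
split; [exact: lower.1 | exact: upper.1 | |].
(* As a boolean, the equality rewrites to the edgewise condition, which [extremal_edges] then
   classifies. *)
- rewrite (rwP eqP) lower.2 (isomorphic_star hn n_gt0) (isomorphic_complete hn).
  rewrite -(extremal_edges hconn hdelta) hn.
  apply: iff_sym; apply: rwP; apply: edges_forallP => a b; exact: end_valuesC.
- rewrite (rwP eqP) upper.2 -(connected_regular hconn hdelta).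
  by apply: iff_sym; apply: rwP; apply: edges_forallP => a b; rewrite eq_sym.
Qed.
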